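(* Let $H=(V,B)$ be a hypergraph with vertex set $V=\{x_1,\dots,x_n\}$, let $k$ be a field, let $J_H\subseteq k[V]=k[x_1,\dots,x_n]$ be the cover ideal of $H$, let $\tau(H)=\min_{b\in B}|b|$, and let $d\ge 1$ be an integer. If $H$ is not $d$-coverable, then $$J_H^{(\tau(H))}\nsubseteq J_H^{d}.$$
   Context: A hypergraph is a pair $H=(V,B)$ where $V=\{x_1,\dots,x_n\}$ is a finite nonempty set (vertices) and $B$ is a family of nonempty subsets of $V$ (edges) whose union is $V$. For an integer $c$, $H$ is $c$-coverable if there exists a partition $U_1,\dots,U_c$ of $V$ such that $e\cap U_i\ne\emptyset$ for each $i=1,\dots,c$ and each edge $e\in B$. For $\sigma=\{x_{i_1},\dots,x_{i_s}\}\subseteq V$ let $\mathfrak p_\sigma=(x_{i_1},\dots,x_{i_s})\subseteq k[V]$. The cover ideal of $H$ is $J_H=\bigcap_{\sigma\in B}\mathfrak p_\sigma$. For a radical ideal $J$, the $m$-th symbolic power is $J^{(m)}=\bigcap_{\mathfrak p\in\mathrm{Ass}(J)}\mathfrak p^m$. *)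

(* Defs.v *)
From HB Require Import structures.
From mathcomp Require Import all_boot all_order all_algebra.
From mathcomp Require Import mpoly.

Set Implicit Arguments.
Unset Strict Implicit.
Unset Printing Implicit Defensive.

Import GRing.Theory.
Local Open Scope ring_scope.

(* Ideals are Prop-valued predicates: the [idealr] of ring_quotient only covers
   ideals with decidable membership, too few to quantify over all the
   associated primes of an ideal. *)
Section Ideals.
Variable R : comNzRingType.
Implicit Types (I J P S : R -> Prop) (m : nat).

Definition ideal I : Prop :=
  [/\ I 0, forall f g, I f -> I g -> I (f + g) & forall a f, I f -> I (a * f)].

Definition prime_ideal P : Prop :=
  [/\ ideal P, ~ P 1 & forall f g, P (f * g) -> P f \/ P g].

Definition ideal_gen S : R -> Prop := fun f =>
  exists (r : nat) (a s : 'I_r -> R),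
    (forall i, S (s i)) /\ f = \sum_(i < r) a i * s i.

Definition ideal_pow I m : R -> Prop :=
  ideal_gen (fun f => exists g : 'I_m -> R,
    (forall i, I (g i)) /\ f = \prod_(i < m) g i).

(* P \in Ass(R / J), i.e. P is prime and of the form (J : h) *)
Definition associated_prime J P : Prop :=
  prime_ideal P /\ exists h, forall f, P f <-> J (f * h).

Definition symbolic_pow J m : R -> Prop := fun f =>
  forall P, associated_prime J P -> ideal_pow P m f.

End Ideals.

(* Vertex set 'I_n, with i : 'I_n standing for the variable 'X_i *)
Record hypergraph (n : nat) := Hypergraph {
  edges : {set {set 'I_n}};
  vertices_gt0 : (0 < n)%N;
  edges_neq0 : set0 \notin edges;
  edges_cover : cover edges = [set: 'I_n]
}.

Section Hypergraphs.
Variables (n : nat) (H : hypergraph n).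

Definition coverable (c : nat) : Prop :=
  exists2 U : {set {set 'I_n}}, partition U [set: 'I_n] /\ #|U| = c &
    forall u e : {set 'I_n}, u \in U -> e \in edges H -> e :&: u != set0.

(* The minimum of the #|b|; the default n is harmless, since every #|b| is at
   most n and there is at least one edge. *)
Definition tau : nat := \big[minn/n]_(b in edges H) #|b|.

Variable k : fieldType.

Definition var_ideal (s : {set 'I_n}) : {mpoly k[n]} -> Prop :=
  ideal_gen (fun f => exists2 i, i \in s & f = 'X_i).

Definition cover_ideal : {mpoly k[n]} -> Prop := fun f =>
  forall s, s \in edges H -> var_ideal s f.

End Hypergraphs.

(* Main.v *)
Require Import Defs.
From Stdlib Require Import ClassicalEpsilon.
From mathcomp Require Import all_boot all_order all_algebra.
From mathcomp Require Import mpoly.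

(** The witness is the product of all the variables.  A prime associated to
    [J_H] contains [J_H], hence contains all the variables of some edge, of which
    there are at least [tau H]; so the witness lies in the symbolic power.  If it
    were in the [d]-th power of [J_H], the squarefree monomial [x_1 ... x_n] would
    be a multiple of a product of [d] monomials from the supports of elements of
    [J_H]; their supports would be [d] pairwise disjoint sets meeting every edge,
    and adding the remaining vertices to one of them would give a [d]-covering. *)

Set Implicit Arguments.
Unset Strict Implicit.
Unset Printing Implicit Defensive.

Import Order.TTheory GRing.Theory.
Local Open Scope ring_scope.

Section IdealTheory.
Variable R : comNzRingType.
Implicit Types (I P S : R -> Prop).

Lemma ideal_gen_mem S f : S f -> ideal_gen S f.
Proof.
move=> Sf; exists 1%N, (fun=> 1), (fun=> f); split=> //.
by rewrite big_ord1 mul1r.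
Qed.

Lemma ideal_gen_mull S a f : ideal_gen S f -> ideal_gen S (a * f).
Proof.
case=> r [b [s [Ss ->]]]; exists r, (fun i => a * b i), s; split=> //.
by rewrite mulr_sumr; apply: eq_bigr => i _; rewrite mulrA.
Qed.

Lemma prime_ideal_prod P (T : finType) (A : {set T}) (F : T -> R) :
  prime_ideal P -> P (\prod_(i in A) F i) -> exists2 i, i \in A & P (F i).
Proof.
move=> [_ P1 PM]; elim/big_rec: _ => [/P1 // | i x Ai IH /PM[PFi|/IH //]].
by exists i.
Qed.

(** Any [m] indices of [A] supply the factors of a generator of the power; all remaining factors,
    inside [A] or not, go into its coefficient. *)
Lemma ideal_pow_prod I m (T : finType) (A : {set T}) (F : T -> R) :
    (m <= #|A|)%N -> (forall i, i \in A -> I (F i)) ->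
  ideal_pow I m (\prod_i F i).
Proof.
move=> le_mA IF; pose g (j : 'I_m) := enum_val (widen_ord le_mA j).
have g_inj : injective g.
  by move=> j1 j2 /enum_val_inj/(congr1 val)/= /val_inj.
rewrite (bigID (mem (g @: setT))) /= mulrC; apply/ideal_gen_mull/ideal_gen_mem.
exists (F \o g); split=> [j|]; first exact/IF/enum_valP.
rewrite (big_imset _ (in2W g_inj)) /=.
by apply: eq_bigl => j; rewrite inE.
Qed.

End IdealTheory.

(** Cancellation may remove monomials from a product but never creates new ones, so only this
    direction holds in general. *)
Lemma msupp_prod n (R : nzRingType) d (g : 'I_d -> {mpoly R[n]}) m :
    m \in msupp (\prod_(j < d) g j) ->
  exists2 c : 'I_d -> 'X_{1..n},
    forall j, c j \in msupp (g j) & m = (\sum_(j < d) c j)%MM.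
Proof.
elim: d g m => [|d IHd] g m.
  rewrite !big_ord0 msupp1 inE => /eqP->; exists (fun=> 0%MM); first by case.
  by rewrite big_ord0.
rewrite big_ord_recl => /msuppM_le/allpairsP[[m1 m2] /= [m1g /IHd[c cg ->] ->]].
exists (fun j => if unlift ord0 j is Some j' then c j' else m1) => [j|].
  by case: unliftP => [j'|] ->.
rewrite big_ord_recl unlift_none; congr (_ + _)%MM.
by apply: eq_bigr => j _; rewrite liftK.
Qed.

Section CoverIdeal.
Variables (n : nat) (H : hypergraph n).

Lemma tau_le_edge (e : {set 'I_n}) : e \in edges H -> (tau H <= #|e|)%N.
Proof. by move=> eH; apply: (@bigmin_inf _ nat _ n e). Qed.

Lemma edge_exists : exists e, e \in edges H.
Proof.
have /bigcupP[e eH _] : Ordinal (vertices_gt0 H) \in cover (edges H).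
  by rewrite edges_cover inE.
by exists e.
Qed.

Lemma coverable_disjoint d (C : 'I_d -> {set 'I_n}) :
    (0 < d)%N ->
    (forall j e, e \in edges H -> e :&: C j != set0) ->
    (forall i j1 j2, i \in C j1 -> i \in C j2 -> j1 = j2) ->
  coverable H d.
Proof.
case: d C => // d C _ C_cover C_disj.
(* The default [ord0] sends the vertices outside every [C j] to the first class; classes only grow,
   so they still meet every edge. *)
pose col i := odflt ord0 [pick j | i \in C j].
have colC i j : i \in C j -> col i = j.
  rewrite /col => iCj; case: pickP => [j' iCj' /=|/(_ j)]; last by rewrite iCj.
  exact: C_disj iCj' iCj.
(* One edge suffices to make every class nonempty, whence exactly [d] distinct blocks. *)
have [e0 e0H] := edge_exists.
have col_surj j : exists i, col i = j.
  by have /set0Pn[i /setIP[_ /colC]] := C_cover j _ e0H; exists i.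
pose B j := [set i | col i == j].
have B_inj : injective B.
  move=> j1 j2 /setP eqB; have [i coli] := col_surj j1.
  by have := eqB i; rewrite !inE coli eqxx => /esym/eqP.
exists (B @: setT); first split.
- apply/and3P; split.
  + apply/eqP/setP=> i; rewrite inE; apply/bigcupP.
    by exists (B (col i)); rewrite ?imset_f // inE.
  + apply/trivIsetP=> _ _ /imsetP[j1 _ ->] /imsetP[j2 _ ->] neB.
    rewrite -setI_eq0; apply: contraNT neB => /set0Pn[i].
    by rewrite !inE => /andP[/eqP-> /eqP->].
  + apply/imsetP=> -[j _ /setP B0]; have [i coli] := col_surj j.
    by have := B0 i; rewrite !inE coli eqxx.
- by rewrite card_imset // cardsT card_ord.
move=> _ e /imsetP[j _ ->] eH.
have /set0Pn[i /setIP[ie /colC coli]] := C_cover j _ eH.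
by apply/set0Pn; exists i; rewrite !inE ie coli /=.
Qed.

Variable k : fieldType.

Lemma var_ideal_msupp (s : {set 'I_n}) (f : {mpoly k[n]}) m :
  var_ideal s f -> m \in msupp f -> exists2 i, i \in s & m i != 0%N.
Proof.
case=> r [a [x [xs ->]]] /msupp_sum_le/flattenP[/= _ /mapP[j _ ->]].
have [i is_ ->] := xs j.
rewrite (perm_mem (msuppMX _ _)) => /mapP[m' _ ->]; exists i => //.
by rewrite mnmDE mnm1E eqxx.
Qed.

(** If the set [W] of variables outside [P] met every edge, the product over [W] would lie in the
    cover ideal, hence in [P], and primality would put a variable of [W] in [P]. So some edge avoids
    [W]. *)
Lemma associated_prime_cover_ideal (P : {mpoly k[n]} -> Prop) :
    associated_prime (cover_ideal H (k:=k)) P ->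
  exists2 e, e \in edges H & forall i, i \in e -> P 'X_i.
Proof.
move=> [Pprime [h Ph]].
pose W := [set i | ~~ excluded_middle_informative (P 'X_i)].
have WP i : i \notin W -> P 'X_i.
  by rewrite inE negbK; case: excluded_middle_informative.
have [/exists_inP[e eH /pred0P eW]|/exists_inPn noe] :=
    boolP [exists e in edges H, [disjoint e & W]].
  by exists e => // i ie; apply: WP; have := eW i; rewrite /= ie /= => ->.
have : P (\prod_(i in W) 'X_i).
  apply/Ph => e /noe/pred0Pn[i /= /andP[ie iW]].
  rewrite (bigD1 i iW) /= -mulrA mulrC; apply/ideal_gen_mull/ideal_gen_mem.
  by exists i.
case/(prime_ideal_prod Pprime) => i.
by rewrite inE; case: excluded_middle_informative.
Qed.

Lemma symbolic_pow_prodX :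
  symbolic_pow (cover_ideal H (k:=k)) (tau H) (\prod_i 'X_i).
Proof.
move=> P /associated_prime_cover_ideal[e eH Pe].
exact: ideal_pow_prod (tau_le_edge eH) Pe.
Qed.

Lemma coverable_of_prodX d :
    (0 < d)%N -> ideal_pow (cover_ideal H (k:=k)) d (\prod_i 'X_i) ->
  coverable H d.
Proof.
move=> d_gt0 [r [a [x [xJ prodE]]]].
pose u : 'X_{1..n} := [multinom 1%N | i < n].
have : u \in msupp (\prod_i 'X_i : {mpoly k[n]}).
  suff <- : 'X_[u] = \prod_i 'X_i :> {mpoly k[n]} by rewrite msuppX inE.
  by rewrite mpolyXE_id; apply: eq_bigr => i _; rewrite mnmE expr1.
(* The monomial [u] survives in some summand [a l * x l]; there it splits as [m0], from the
   coefficient, plus one exponent vector [c j] from each factor [g j]. *)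
rewrite prodE => /msupp_sum_le/flattenP[/= _ /mapP[l _ ->]].
have [g [gJ ->]] := xJ l.
case/msuppM_le/allpairsP=> -[m0 m1] /= [_ /msupp_prod[c cg ->] /mnmP uE].
apply: (@coverable_disjoint _ (fun j => [set i | c j i != 0%N])) => // [j e eH|].
  have [i ie ci] := var_ideal_msupp (gJ j e eH) (cg j).
  by apply/set0Pn; exists i; rewrite !inE ie.
(* A vertex shared by two supports would have exponent at least 2 in [u], where every exponent is
   1. *)
move=> i j1 j2; rewrite !inE => c1 c2; apply/eqP/negPn/negP => ne12.
have := uE i; rewrite mnmE mnmDE mnm_sumE (bigD1 j1) //= (bigD1 j2) 1?eq_sym //=.
by case: (c j1 i) (c j2 i) c1 c2 => [|p] [|q] // _ _; rewrite addSn !addnS.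
Qed.

End CoverIdeal.

Theorem theorem4p8 (n : nat) (H : hypergraph n) (k : fieldType) (d : nat) :
  (1 <= d)%N ->
  ~ coverable H d ->
  ~ (forall f : {mpoly k[n]},
       symbolic_pow (cover_ideal H (k:=k)) (tau H) f ->
       ideal_pow (cover_ideal H (k:=k)) d f).
Proof.
move=> d_gt0 noncov sub; apply: noncov.
by apply: (coverable_of_prodX (k:=k)) => //; apply/sub/symbolic_pow_prodX.
Qed.
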